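(* Let $\mathcal{C}(d,n,z)$ be a set of coherent states $|a_z(\hat r,\mu)\rangle=X^{\hat r}|a_z(0,\mu)\rangle\in H(d)$, $\hat r\in\mathbb{Z}_d$, $\mu=0,\dots,\frac nd-1$. For $\mu,\nu\in\{0,\dots,\frac nd-1\}$ define the overlap matrix $$\mathcal{T}_{\mu\nu}(\hat r,\hat s)=\langle a_z(\hat r,\mu)|a_z(\hat s,\nu)\rangle,\qquad \hat r,\hat s\in\mathbb{Z}_d,$$ and the orbit matrix $$\sigma_{\mu\nu}(\hat s,\hat r)=\frac1d\sum_{\hat q=0}^{d-1}\langle X;\hat s|a_z(\hat q,\nu)\rangle\langle a_z(\hat q,\mu)|X;\hat r\rangle,\qquad \hat r,\hat s\in\mathbb{Z}_d .$$ Then $\mathcal{T}_{\mu\nu}$ and $d\,\sigma_{\mu\nu}$ are both $d\times d$ circulant matrices, and they are transposes of each other: $$\mathcal{T}_{\mu\nu}(\hat r,\hat s)=d\,\sigma_{\mu\nu}(\hat s,\hat r)\qquad\text{for all }\hat r,\hat s\in\mathbb{Z}_d .$$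
   Context: $H(d)=\mathbb{C}^d$ with inner product antilinear in the first argument and orthonormal ``position'' basis $|X;s\rangle$, $s\in\mathbb{Z}_d$ (integers modulo $d$). $X$ is the $d\times d$ cyclic permutation matrix with $X^r|X;s\rangle=|X;s-r\rangle$ (indices mod $d$), so $X^d=\mathbf{1}_d$. A $d\times d$ matrix $T$ is circulant if $T(\hat r+k,\hat s+k)=T(\hat r,\hat s)$ for all $\hat r,\hat s,k\in\mathbb{Z}_d$ (equivalently, if it commutes with $X$). A set of coherent states $\mathcal{C}(d,n,z)$ ($n$ an integer multiple of $d$, $z$ a complex parameter with $|z|=1$) is a set of $n$ normalised vectors in $H(d)$ indexed by pairs $(\hat r,\mu)$, $\hat r\in\mathbb{Z}_d$, $\mu\in\{0,\dots,\frac nd-1\}$, such that: $|a_z(\hat r,\mu)\rangle=X^{\hat r}|a_z(0,\mu)\rangle$; each orbit (fixed $\mu$) has exactly $d$ elements; $\frac dn\sum_{\mu}\sum_{\hat r}|a_z(\hat r,\mu)\rangle\langle a_z(\hat r,\mu)|=\mathbf{1}_d$; $\langle a_z(\hat r,\mu)|a_z(\hat r,\nu)\rangle=\delta_{\mu\nu}$; and the family of $n$ numbers $|\langle a_z(\hat r,\mu)|a_z(\hat s,\nu)\rangle|^2$, over all $(\hat s,\nu)$ (with multiplicity), is the same for all $(\hat r,\mu)$. *)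

(* Defs.v *)
From HB Require Import structures.
From mathcomp Require Import all_boot all_order all_algebra.
From mathcomp Require Export complex.
From mathcomp Require Import reals.

Set Implicit Arguments.
Unset Strict Implicit.
Unset Printing Implicit Defensive.

Import Order.TTheory GRing.Theory Num.Theory.
Local Open Scope ring_scope.
Local Open Scope sesquilinear_scope.

(* The dimension is d = d'.+1 >= 1. Then 'I_d'.+1, with its canonical additive
   group structure (addition modulo d), is Z_d for every d >= 1, including
   d = 1, and H(d) = C^d is the type 'cV[R[i]]_d'.+1. *)

Section Definitions.
Variables (R : realType) (d' : nat).
Local Notation d := d'.+1.
Local Notation C := R[i].

(* <u|v>, antilinear in u *)
Definition braket (u v : 'cV[C]_d) : C := (u^t* *m v) 0 0.

(* |u><v| *)
Definition ketbra (u v : 'cV[C]_d) : 'M[C]_d := u *m v^t*.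

(* |X;s> *)
Definition pos (s : 'I_d) : 'cV[C]_d := delta_mx s 0.

(* The column of index s is |X;s-1>; see shiftX_pos. The class Zp1 of 1 is
   used since 'I_1 has no ring structure, hence no 1. *)
Definition shiftX : 'M[C]_d := \matrix_(i, j) (i == j - Zp1)%:R.

Lemma shiftX_pos (r s : 'I_d) : shiftX ^+ r *m pos s = pos (s - r).
Proof.
have X1 t : shiftX *m pos t = pos (t - Zp1).
  by rewrite -colE; apply/colP => i; rewrite !mxE eqxx andbT.
suff Xk k : shiftX ^+ k *m pos s = pos (s - inZp k) by rewrite Xk valZpK.
elim: k => [|k IHk].
  by rewrite expr0 mul1mx (_ : inZp 0 = 0) ?subr0 //; apply/val_inj/mod0n.
rewrite exprS -mulmxA IHk X1 -addrA -opprD; congr (pos (s - _)).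
by apply/val_inj; rewrite /= modnDm addn1.
Qed.

Definition circulant (T : 'M[C]_d) : Prop :=
  forall r s k : 'I_d, T (r + k) (s + k) = T r s.

(* a z r mu stands for |a_z(r, mu)>; only its values at the given z matter.
   The number of orbits n / d is the integer n %/ d, since d %| n. *)
Record coherent_set (n : nat) (z : C)
    (a : C -> 'I_d -> 'I_(n %/ d) -> 'cV[C]_d) : Prop := CoherentSet {
  coherent_dvd : (d %| n)%N;
  coherent_param : `|z| = 1;
  coherent_card :
    size (undup [seq a z p.1 p.2 | p : 'I_d * 'I_(n %/ d)]) = n;
  coherent_normalised : forall r mu, braket (a z r mu) (a z r mu) = 1;
  coherent_shift : forall r mu, a z r mu = shiftX ^+ r *m a z 0 mu;
  coherent_orbit_card : forall mu, size (undup [seq a z r mu | r : 'I_d]) = d;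
  coherent_resolution :
    (d%:R / n%:R) *: (\sum_mu \sum_r ketbra (a z r mu) (a z r mu)) = 1%:M;
  coherent_orthogonal :
    forall r mu nu, braket (a z r mu) (a z r nu) = (mu == nu)%:R;
  (* equality of the families of overlaps as multisets *)
  coherent_overlaps : forall r mu r' mu',
    perm_eq
      [seq `|braket (a z r mu) (a z p.1 p.2)| ^+ 2
         | p : 'I_d * 'I_(n %/ d)]
      [seq `|braket (a z r' mu') (a z p.1 p.2)| ^+ 2
         | p : 'I_d * 'I_(n %/ d)]
}.

Definition overlap_mx n (a : C -> 'I_d -> 'I_(n %/ d) -> 'cV[C]_d) (z : C)
    (mu nu : 'I_(n %/ d)) : 'M[C]_d :=
  \matrix_(r, s) braket (a z r mu) (a z s nu).

Definition orbit_mx n (a : C -> 'I_d -> 'I_(n %/ d) -> 'cV[C]_d) (z : C)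
    (mu nu : 'I_(n %/ d)) : 'M[C]_d :=
  \matrix_(s, r) (d%:R^-1 * \sum_(q < d)
    braket (pos s) (a z q nu) * braket (a z q mu) (pos r)).

End Definitions.

(* Main.v *)
Require Import Defs.
From mathcomp Require Import all_boot all_order all_algebra.
From mathcomp Require Import reals.
Import GRing.Theory.
Local Open Scope ring_scope.

(** Since [X^r] translates position components, [(X^r v)_i = v_(i + r)], both
    [T(r, s)] and [d sigma(s, r)] are the correlation sum
    [\sum_q conj(u_(r + q)) w_(s + q)] of the fiducial vectors
    [u = a_z(0, mu)] and [w = a_z(0, nu)]: in the former [q] runs over
    positions, in the latter over the orbit. *)

Lemma shiftX_expE (R : realType) (d' : nat) (r : 'I_d'.+1)
    (v : 'cV[R[i]]_d'.+1) (i : 'I_d'.+1) :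
  (shiftX R d' ^+ r *m v) i 0 = v (i + r) 0.
Proof.
(* Column [j] of [X^r] is the basis vector at [j - r], so row [i] has its only nonzero entry in
   column [i + r]. *)
have Xr j : (shiftX R d' ^+ r) i j = (j == i + r)%:R.
  have /colP/(_ i) := @shiftX_pos R d' r j.
  by rewrite -colE !mxE eqxx andbT [i == _]eq_sym subr_eq.
rewrite mxE (bigD1 (i + r)) //= Xr eqxx mul1r big1 ?addr0 // => j /negPf ne.
by rewrite Xr ne mul0r.
Qed.

Lemma braketE (R : realType) (d' : nat) (u v : 'cV[R[i]]_d'.+1) :
  braket u v = \sum_i (u i 0)^* * v i 0.
Proof. by rewrite /braket mxE; apply: eq_bigr => i _; rewrite !mxE. Qed.

Lemma braket_posl (R : realType) (d' : nat) (s : 'I_d'.+1)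
    (v : 'cV[R[i]]_d'.+1) :
  braket (pos R s) v = v s 0.
Proof.
rewrite braketE (bigD1 s) //= mxE !eqxx rmorph1 mul1r.
by rewrite big1 ?addr0 // => j /negPf ne; rewrite mxE ne rmorph0 mul0r.
Qed.

Lemma braket_posr (R : realType) (d' : nat) (r : 'I_d'.+1)
    (u : 'cV[R[i]]_d'.+1) :
  braket u (pos R r) = (u r 0)^*.
Proof.
rewrite braketE (bigD1 r) //= mxE !eqxx mulr1.
by rewrite big1 ?addr0 // => j /negPf ne; rewrite mxE ne mulr0.
Qed.

Lemma overlap_mxE (R : realType) (d' n : nat) (z : R[i])
    (a : R[i] -> 'I_d'.+1 -> 'I_(n %/ d'.+1) -> 'cV[R[i]]_d'.+1)
    (Ha : coherent_set z a) (mu nu : 'I_(n %/ d'.+1))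
    (r s : 'I_d'.+1) :
  overlap_mx a z mu nu r s
    = \sum_i (a z 0 mu (i + r) 0)^* * a z 0 nu (i + s) 0.
Proof.
rewrite mxE braketE; apply: eq_bigr => i _.
by rewrite (coherent_shift Ha r) (coherent_shift Ha s) !shiftX_expE.
Qed.

(** The brackets with position vectors pick out the components of [X^q w] at [s] and of [X^q u] at
    [r]. Compared with [overlap_mxE], shift and position exchange roles: [q] is now the shift, while
    [r] and [s] are positions. The factor [d] cancels the normalisation of the orbit average. *)
Lemma orbit_mxE (R : realType) (d' n : nat) (z : R[i])
    (a : R[i] -> 'I_d'.+1 -> 'I_(n %/ d'.+1) -> 'cV[R[i]]_d'.+1)
    (Ha : coherent_set z a) (mu nu : 'I_(n %/ d'.+1))
    (r s : 'I_d'.+1) :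
  d'.+1%:R * orbit_mx a z mu nu s r
    = \sum_q a z 0 nu (s + q) 0 * (a z 0 mu (r + q) 0)^*.
Proof.
rewrite mxE mulVKf ?Num.Theory.pnatr_eq0 //; apply: eq_bigr => q _.
by rewrite braket_posl braket_posr !(coherent_shift Ha q) !shiftX_expE.
Qed.

(** A component of a shifted vector depends only on the sum of position and shift, so the two
    correlation sums agree term by term. *)
Lemma overlap_orbit (R : realType) (d' n : nat) (z : R[i])
    (a : R[i] -> 'I_d'.+1 -> 'I_(n %/ d'.+1) -> 'cV[R[i]]_d'.+1)
    (Ha : coherent_set z a) (mu nu : 'I_(n %/ d'.+1))
    (r s : 'I_d'.+1) :
  overlap_mx a z mu nu r s = d'.+1%:R * orbit_mx a z mu nu s r.
Proof.
rewrite (overlap_mxE _ _ _ _ _ Ha) (orbit_mxE _ _ _ _ _ Ha); apply: eq_bigr => q _.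
by rewrite mulrC ![q + _]addrC.
Qed.

Lemma overlap_circulant (R : realType) (d' n : nat) (z : R[i])
    (a : R[i] -> 'I_d'.+1 -> 'I_(n %/ d'.+1) -> 'cV[R[i]]_d'.+1)
    (Ha : coherent_set z a) (mu nu : 'I_(n %/ d'.+1)) :
  circulant (overlap_mx a z mu nu).
Proof.
(* The common shift [k] is absorbed by translating the summation index, a bijection of [Z_d]. *)
move=> r s k; rewrite !(overlap_mxE _ _ _ _ _ Ha) [RHS](reindex_inj (addIr k)).
by apply: eq_bigr => i _; rewrite ![_ + k]addrC !addrA ![_ + k]addrC.
Qed.

Theorem mainTheorem2 (R : realType) (d' n : nat) (z : R[i])
    (a : R[i] -> 'I_d'.+1 -> 'I_(n %/ d'.+1) -> 'cV[R[i]]_d'.+1)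
    (Ha : coherent_set z a) (mu nu : 'I_(n %/ d'.+1)) :
  [/\ circulant (overlap_mx a z mu nu),
      circulant (d'.+1%:R *: orbit_mx a z mu nu),
      overlap_mx a z mu nu = (d'.+1%:R *: orbit_mx a z mu nu)^T &
      forall r s : 'I_d'.+1,
        overlap_mx a z mu nu r s = d'.+1%:R * orbit_mx a z mu nu s r].
Proof.
have orbitE r s : (d'.+1%:R *: orbit_mx a z mu nu) r s
    = overlap_mx a z mu nu s r.
  by rewrite (overlap_orbit _ _ _ _ _ Ha) mxE.
split; first exact: overlap_circulant.
(* Circulance shifts both indices by the same [k], so it passes to the transpose. *)
- by move=> r s k; rewrite !orbitE; apply: overlap_circulant.
- by apply/matrixP => r s; rewrite [RHS]mxE orbitE.
- by move=> r s; apply: overlap_orbit.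
Qed.
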